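(* Let $A\in\mathbb{R}^{n\times n}$ be such that $\mathcal{G}(A)$ is a clustering balanced directed graph with $k$ clusters $\mathcal{V}_1,\dots,\mathcal{V}_k$. Assume that the set of leaders $\mathcal{L}$ coincides with one of the clusters, e.g. $\mathcal{L}=\mathcal{V}_1$, and let $B\in\mathbb{R}^{n\times m}$, with $m=|\mathcal{L}|<n$, be the selection matrix whose columns are the canonical vectors $\mathbf{e}_\ell$, $\ell\in\mathcal{L}$. If for every $p\in\{2,\dots,k\}$ and every $i\in\mathcal{V}_p$ there exists $\ell_i\in\mathcal{L}=\mathcal{V}_1$ such that $$d(\ell_i,i)<d(\ell_i,j)\qquad\text{for all } j\in\bigcup_{h\notin\{1,p\}}\mathcal{V}_h ,$$ then the pair $(A,B)$ is herdable.
   Context: Graph of a matrix: for $A\in\mathbb{R}^{n\times n}$, $\mathcal{G}(A)$ is the signed weighted directed graph with node set $\{1,\dots,n\}$ and an arc $(j,i)$ from $j$ to $i$ if and only if $[A]_{ij}\neq 0$, with weight $[A]_{ij}$. A walk of length $q$ from $j$ to $i$ is a sequence of $q$ consecutive arcs leading from $j$ to $i$. The distance $d(j,i)$ is the minimum length of a walk from $j$ to $i$, with $d(j,i)=+\infty$ if there is none. Clustering balance: $\mathcal{G}(A)$ is clustering balanced with $k\ge 2$ clusters if all its nodes can be partitioned into $k$ disjoint subsets $\mathcal{V}_1,\dots,\mathcal{V}_k$ such that $[A]_{ij}\ge 0$ whenever $i,j$ belong to the same $\mathcal{V}_p$, and $[A]_{ij}\le 0$ whenever $i\in\mathcal{V}_p$,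 $j\in\mathcal{V}_q$ with $p\ne q$. Leaders: the leaders are the nodes to which an external input is directly applied, i.e. the indices of the nonzero rows of the selection matrix $B$ (a selection matrix is an $n\times m$ submatrix of the identity matrix $I_n$). Herdability: a pair $(A,B)$, $A\in\mathbb{R}^{n\times n}$, $B\in\mathbb{R}^{n\times m}$, describing a linear time-invariant (continuous-time or discrete-time) system $\dot{\mathbf x}=A\mathbf{x}+B\mathbf{u}$ or $\mathbf{x}(t+1)=A\mathbf{x}(t)+B\mathbf{u}(t)$, is herdable if for every $\mathbf{x}(0)$ and every $h>0$ there exist $t_f>0$ and an input $\mathbf{u}(t)$, $t\in[0,t_f)$, driving the state from $\mathbf{x}(0)$ to $\mathbf{x}(t_f)\ge h\mathbf{1}_n$ (entrywise, where $\mathbf{1}_n$ is the vector of all ones). It is known that this is equivalent to the image of the controllability matrix $\mathcal{R}(A,B)=[B\ \ AB\ \ \cdots\ \ A^{n-1}B]$ containing a vector with all entries strictly positive.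
   Formalization: The distance d(ℓ_i,i) is also required to be finite; this is automatic for k≥3, but for k=2 the printed condition is vacuous and the claim fails (n=2, A=0, V_1={1}, V_2={2}, B=e_1). *)

(* Defs.v *)
From HB Require Import structures.
From mathcomp Require Import all_boot all_order all_algebra.
From mathcomp Require Import all_classical all_reals all_analysis.

Set Implicit Arguments.
Unset Strict Implicit.
Unset Printing Implicit Defensive.

Import Order.TTheory GRing.Theory Num.Theory.
Import numFieldNormedType.Exports.

Local Open Scope classical_set_scope.
Local Open Scope ring_scope.

(* [arc A j i] is the arc from j to i; its weight is [A i j]. *)
Definition arc (R : realType) (n : nat) (A : 'M[R]_n) : rel 'I_n :=
  fun j i => A i j != 0.

(* The walk is given by its start j and the list s of the heads of its arcs,
   so that its length is [size s]. *)
Definition walk (R : realType) (n : nat) (A : 'M[R]_n) (j i : 'I_n)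
    (s : seq 'I_n) : Prop :=
  path (arc A) j s /\ last j s = i.

(* The infimum of the empty set in [\bar R] is +oo. The empty walk is allowed,
   so the distance from a node to itself is 0. *)
Definition distance (R : realType) (n : nat) (A : 'M[R]_n) (j i : 'I_n) :
    \bar R :=
  ereal_inf [set ((size s)%:R)%:E | s in [set s | walk A j i s]].

(* As [V] is injective and [finset.partition] excludes empty blocks, the [V p]
   are k nonempty, pairwise disjoint sets covering the nodes. *)
Definition clustering_balanced (R : realType) (n k : nat) (A : 'M[R]_n)
    (V : 'I_k -> {set 'I_n}) : Prop :=
  [/\ (2 <= k)%N,
      injective V,
      finset.partition [set V p | p : 'I_k]%SET [set: 'I_n]%SET,
      (forall (p : 'I_k) (i j : 'I_n), i \in V p -> j \in V p -> 0 <= A i j)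
    & (forall (p q : 'I_k) (i j : 'I_n), p != q ->
         i \in V p -> j \in V q -> A i j <= 0)].

Definition selection_matrix (R : realType) (n m : nat) (B : 'M[R]_(n, m)) :
    Prop :=
  exists2 f : 'I_m -> 'I_n, injective f & B = colsub f 1%:M.

Definition leaders (R : realType) (n m : nat) (B : 'M[R]_(n, m)) :
    {set 'I_n} :=
  [set i | row i B != 0]%SET.

(* Inputs are continuous and the differential equation is solved in the
   classical sense. Continuous inputs are admissible under each of the usual
   conventions (piecewise continuous, locally integrable), and the set of
   states reachable from a given one is the same for all of them. *)
Definition herdable_continuous_time (R : realType) (n m : nat)
    (A : 'M[R]_n) (B : 'M[R]_(n, m)) : Prop :=
  forall (x0 : 'cV[R]_n) (h : R), 0 < h ->
  exists (tf : R) (u : R -> 'cV[R]_m) (x : R -> 'cV[R]_n),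
    [/\ 0 < tf,
        (forall j : 'I_m, {within `[0, tf], continuous (fun t : R => u t j 0)}),
        (forall i : 'I_n, {within `[0, tf], continuous (fun t : R => x t i 0)}),
        (forall t : R, 0 < t < tf -> forall i : 'I_n,
           is_derive t 1 (fun s : R => x s i 0) ((A *m x t + B *m u t) i 0))
      & x 0 = x0 /\ forall i : 'I_n, h <= x tf i 0].

Definition herdable_discrete_time (R : realType) (n m : nat)
    (A : 'M[R]_n) (B : 'M[R]_(n, m)) : Prop :=
  forall (x0 : 'cV[R]_n) (h : R), 0 < h ->
  exists (tf : nat) (u : nat -> 'cV[R]_m) (x : nat -> 'cV[R]_n),
    [/\ (0 < tf)%N,
        (forall t : nat, (t < tf)%N -> x t.+1 = A *m x t + B *m u t)
      & x 0%N = x0 /\ forall i : 'I_n, h <= x tf i 0].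

(* Main.v *)
(** The image of the controllability matrix contains a positive vector: if
    [d] is the distance from the leader [l] to a node [i] of the cluster [V p],
    every walk of length at most [d] from [l] stays in [V c :|: V p], so by
    balance [- A ^+ d *m e_l] is nonnegative on all followers and positive at
    [i]. Summing over the followers and adding large multiples of the [e_l],
    which the input reaches directly, makes all entries positive.

    In continuous time, the polynomial trajectories starting from 0 already
    reach the image of the controllability matrix at time 1, because
    [adj (d/dt - A) B y] is the response to the input [chi_A (d/dt) y] for
    every [y]. A large multiple of such a trajectory is added to the free
    response [e^(tA) x0]. *)

Require Import Defs.
From mathcomp Require Import all_boot all_order all_algebra.
From mathcomp Require Import all_classical all_reals all_analysis.
From mathcomp Require Import ring zify.

Set Implicit Arguments.
Unset Strict Implicit.
Unset Printing Implicit Defensive.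

Import Order.TTheory GRing.Theory Num.Theory.
Import numFieldNormedType.Exports.

Local Open Scope classical_set_scope.
Local Open Scope ring_scope.

(** * Subspaces and the image of the controllability matrix *)

Definition subspace (R : realType) (n : nat) (W : set 'cV[R]_n) : Prop :=
  W 0 /\ forall (a : R) (u v : 'cV[R]_n), W u -> W v -> W (a *: u + v).

Lemma subspaceZ (R : realType) (n : nat) (W : set 'cV[R]_n) (a : R) u :
  subspace W -> W u -> W (a *: u).
Proof. by move=> [W0 WD] Wu; rewrite -[_ *: _]addr0; exact: WD. Qed.

Lemma subspaceB (R : realType) (n : nat) (W : set 'cV[R]_n) u v :
  subspace W -> W u -> W v -> W (u - v).
Proof. by move=> [W0 WD] Wu Wv; rewrite addrC -scaleN1r; exact: WD. Qed.

Lemma subspace_sum (R : realType) (n : nat) (W : set 'cV[R]_n) (I : Type)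
    (r : seq I) (P : pred I) (F : I -> 'cV[R]_n) :
  subspace W -> (forall i, P i -> W (F i)) -> W (\sum_(i <- r | P i) F i).
Proof.
move=> [W0 WD] WF; apply: big_ind => // u v Wu Wv.
by rewrite -[u]scale1r; exact: WD.
Qed.

(** The index set of [w] is [nat] rather than ['I_n], so that inputs can be listed in reverse order
    without casts. *)
Definition controllable_image (R : realType) (n m : nat) (A : 'M[R]_n)
    (B : 'M[R]_(n, m)) : set 'cV[R]_n :=
  [set v | exists w : nat -> 'cV[R]_m, v = \sum_(t < n) A ^+ t *m (B *m w t)].

Lemma subspace_controllable_image (R : realType) (n m : nat) (A : 'M[R]_n)
  (B : 'M[R]_(n, m)) : subspace (controllable_image A B).
Proof.
split.
  by exists (fun=> 0); rewrite big1 // => t _; rewrite !mulmx0.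
move=> a u v [w ->] [w' ->]; exists (fun t => a *: w t + w' t).
rewrite scaler_sumr -big_split; apply: eq_bigr => t _ /=.
by rewrite !mulmxDr -!scalemxAr.
Qed.

Lemma controllable_image_pow (R : realType) (n m : nat) (A : 'M[R]_n)
    (B : 'M[R]_(n, m)) (d : nat) (w : 'cV[R]_m) :
  (d < n)%N -> controllable_image A B (A ^+ d *m (B *m w)).
Proof.
move=> dn; exists (fun t => if t == d then w else 0).
rewrite (bigD1 (Ordinal dn)) //= eqxx big1 ?addr0 // => t td.
by rewrite ifN ?mulmx0.
Qed.

(** * Walks and signs of the entries of matrix powers *)

Lemma walk_rcons (R : realType) (n : nat) (A : 'M[R]_n) (l j : 'I_n) s :
  walk A l j s -> forall i, A i j != 0 -> walk A l i (rcons s i).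
Proof.
move=> [ps ls] i Aij; split; last by rewrite last_rcons.
by rewrite rcons_path ps /= ls.
Qed.

Lemma expmxS (R : realType) (n : nat) (A : 'M[R]_n) t :
  A ^+ t.+1 = A *m A ^+ t.
Proof. exact: exprS. Qed.

(** Entry [(j, l)] of [A ^+ t] is a sum over the walks of length [t] from [l] to [j]; a nonzero sum
    has a nonzero term. *)
Lemma walk_of_expmx (R : realType) (n : nat) (A : 'M[R]_n) (l : 'I_n) t j :
  (A ^+ t) j l != 0 -> exists2 s, walk A l j s & size s = t.
Proof.
elim: t j => [|t IHt] j.
  rewrite expr0 mxE; have [-> _|_] := eqVneq j l; last by rewrite eqxx.
  by exists [::].
rewrite expmxS mxE => nz.
have /existsP [k] : [exists k, A j k * (A ^+ t) k l != 0].
  apply: contra_neqT nz => /existsPn nz; apply: big1 => k _.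
  by have := nz k; rewrite negbK => /eqP.
rewrite mulf_eq0 negb_or => /andP[Ajk /IHt [s ws <-]].
by exists (rcons s j); [exact: walk_rcons ws _ Ajk | rewrite size_rcons].
Qed.

(* Conjugating by the signs [sg] turns [A] into a matrix that is nonnegative on
   [S], so that the walks of length [t] cannot cancel in [A ^+ t]. *)
Lemma signed_expmx_ge0 (R : realType) (n : nat) (A : 'M[R]_n) (l : 'I_n)
    (sg : 'I_n -> R) (S : {set 'I_n}) (d : nat) :
    sg l = 1 -> (forall j, sg j * sg j = 1) ->
    {in S &, forall j k, 0 <= sg j * A j k * sg k} ->
    (forall j s, walk A l j s -> (size s <= d)%N -> j \in S) ->
  forall t, (t <= d)%N -> forall j, 0 <= sg j * (A ^+ t) j l /\
    (forall s, walk A l j s -> size s = t -> 0 < sg j * (A ^+ t) j l).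
Proof.
move=> sgl sg2 SA reachS; elim=> [_|t IHt td] j.
  rewrite expr0 mxE; split=> [|s [_ <-] /size0nil -> /=].
    by have [->|_] := eqVneq j l; rewrite ?sgl ?mulr0 ?mulr1.
  by rewrite eqxx sgl mulr1.
have sgM k : sg j * (A j k * (A ^+ t) k l) =
    sg j * A j k * sg k * (sg k * (A ^+ t) k l).
  by rewrite !mulrA -[_ * sg k * sg k]mulrA sg2 mulr1.
(* A nonzero term extends a walk of length [t] to [k] by an arc to [j]; both nodes are within [d]
   arcs of [l], hence in [S]. *)
have term_ge0 k : 0 <= sg j * (A j k * (A ^+ t) k l).
  have [->|Ajk] := eqVneq (A j k) 0; first by rewrite mul0r mulr0.
  have [->|Atk] := eqVneq ((A ^+ t) k l) 0; first by rewrite !mulr0.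
  have [s ws ss] := walk_of_expmx Atk.
  rewrite sgM mulr_ge0 //; last by have [] := IHt (ltnW td) k.
  apply: SA; last by apply: reachS ws _; rewrite ss ltnW.
  by apply: reachS (walk_rcons ws Ajk) _; rewrite size_rcons ss.
rewrite expmxS mxE mulr_sumr; split; first by rewrite sumr_ge0.
move=> s; case/lastP: s => // s i [+ ]; rewrite last_rcons => + ij.
rewrite {}ij rcons_path size_rcons => /andP[ps].
rewrite /arc => Aj [ss]; set k := last l s in Aj.
have wk : walk A l k s by [].
rewrite (bigD1 k) //=; apply: ltr_wpDr; first by rewrite sumr_ge0.
rewrite sgM mulr_gt0 //; last by have [_ /(_ _ wk ss)] := IHt (ltnW td) k.
have sgn0 h : sg h != 0.
  by have /eqP := sg2 h; apply: contraTneq => ->; rewrite mul0r eq_sym oner_eq0.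
rewrite lt0r !mulf_neq0 //=; apply: SA.
  by apply: reachS (walk_rcons wk Aj) _; rewrite size_rcons ss.
by apply: reachS wk _; rewrite ss ltnW.
Qed.

(** * Distances and shortest walks *)

Lemma distance_le (R : realType) (n : nat) (A : 'M[R]_n) (l j : 'I_n) s :
  walk A l j s -> (distance A l j <= (size s)%:R%:E)%E.
Proof. by move=> ws; apply: ereal_inf_lbound; exists s. Qed.

Lemma distance_lt (R : realType) (n : nat) (A : 'M[R]_n) (l j : 'I_n) x :
  (distance A l j < x)%E -> exists2 s, walk A l j s & ((size s)%:R%:E < x)%E.
Proof. by move=> /ereal_inf_lt [_ [s ws <-] sx]; exists s. Qed.

(** Lengths are natural numbers, so a minimum is attained. Removing repeated nodes leaves fewer than
    [n] arcs, which keeps the power of [A] within the controllability matrix. *)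
Lemma shortest_walk (R : realType) (n : nat) (A : 'M[R]_n) (l j : 'I_n) :
    (distance A l j < +oo)%E ->
  exists s, [/\ walk A l j s, (size s < n)%N &
    forall s', walk A l j s' -> (size s <= size s')%N].
Proof.
move=> /distance_lt [s0 ws0 _].
have ex : exists t, `[< exists2 s, walk A l j s & size s = t >].
  by exists (size s0); apply/asboolP; exists s0.
case: (ex_minnP ex) => t /asboolP [s ws st] tmin.
have smin s' : walk A l j s' -> (size s <= size s')%N.
  by move=> ws'; rewrite st; apply: tmin; apply/asboolP; exists s'.
exists s; split => //; have [ps ls] := ws.
case: (shortenP ps) ls => s' ps' us' _ ls.
have sn : (size s' < n)%N.
  by have := max_card [in l :: s']; rewrite (card_uniqP us') card_ord.
by apply: leq_ltn_trans sn; apply: smin; split; rewrite // ls.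
Qed.

(** * From clustering balance to a positive vector *)

Lemma leader_column (R : realType) (n m : nat) (B : 'M[R]_(n, m)) (l : 'I_n) :
    selection_matrix B -> l \in leaders B ->
  exists w : 'cV[R]_m, B *m w = delta_mx l 0.
Proof.
move=> [f _ ->]; rewrite inE => /rV0Pn [j].
rewrite !mxE; have [-> _|_] := eqVneq l (f j); last by rewrite eqxx.
exists (delta_mx j 0); rewrite -colE.
by apply/matrixP => i z; rewrite !mxE ord1 eqxx andbT.
Qed.

Lemma positive_direction (R : realType) (n k : nat) (A : 'M[R]_n)
    (V : 'I_k -> {set 'I_n}) (c : 'I_k) (W : set 'cV[R]_n) :
    clustering_balanced A V ->
    (forall (p : 'I_k) (i : 'I_n), p != c -> i \in V p ->
       exists l : 'I_n,
         [/\ l \in V c,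
             (distance A l i < +oo)%E
           & forall (q : 'I_k) (j : 'I_n), q != c -> q != p -> j \in V q ->
               (distance A l i < distance A l j)%E]) ->
    subspace W ->
    (forall l d, l \in V c -> (d < n)%N -> W (A ^+ d *m delta_mx l 0)) ->
  exists2 v : 'cV[R]_n, W v & forall i, 0 < v i 0.
Proof.
move=> [_ Vinj /and3P[/eqP Vcov /finset.trivIsetP Vtriv _] Apos Aneg] hdist subW WA.
have inV i : exists p, i \in V p.
  have: i \in finset.cover [set V p | p : 'I_k]%SET by rewrite Vcov inE.
  by case/finset.bigcupP => _ /imsetP[p _ ->] ip; exists p.
have Vuniq p q i : i \in V p -> i \in V q -> p = q.
  move=> ip iq; apply: Vinj; apply/eqP; apply/negP => /negP npq.
  have VI r : V r \in [set V p | p : 'I_k]%SET by exact: imset_f.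
  have := Vtriv _ _ (VI p) (VI q) npq.
  by rewrite finset.disjoints_subset => /fintype.subsetP /(_ i ip); rewrite inE iq.
have e_leader l : l \in V c -> (0 < n)%N -> W (delta_mx l 0).
  by move=> lc n0; have := WA l 0%N lc n0; rewrite expr0 mul1mx.
(* One vector per node; its entries at the leaders may have any sign and are corrected at the
   end. *)
have /choice [u uP] (i : 'I_n) : exists u, [/\ W u, 0 < u i 0 &
    forall j, j \notin V c -> 0 <= u j 0].
  have n0 : (0 < n)%N by apply: leq_ltn_trans (ltn_ord i).
  have [ic|ic] := boolP (i \in V c).
    exists (delta_mx i 0); split=> [||j jc]; first exact: e_leader.
      by rewrite mxE !eqxx.
    by rewrite mxE ler0n.
  have [p ip] := inV i.
  have pc : p != c by apply: contraNneq ic => <-.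
  have [l [lc dfin dlt]] := hdist p i pc ip.
  have [s [ws sn smin]] := shortest_walk dfin.
  pose sg j : R := if j \in V c then 1 else -1.
  have sgl : sg l = 1 by rewrite /sg lc.
  have sg2 j : sg j * sg j = 1 by rewrite /sg; case: ifP; rewrite ?mulrNN mulr1.
  have SA : {in (V c :|: V p)%SET &, forall j k, 0 <= sg j * A j k * sg k}.
    have pNc j : j \in V p -> (j \in V c) = false.
      by move=> jp; apply: contraNF pc => jc; rewrite (Vuniq _ _ _ jp jc).
    move=> j h; rewrite !inE => /orP[jc|jp] /orP[hc|hp]; rewrite /sg.
    - by rewrite jc hc mul1r mulr1 (Apos c).
    - by rewrite jc pNc // mul1r mulrN1 oppr_ge0 (Aneg c p) // eq_sym.
    - by rewrite pNc // hc mulN1r mulr1 oppr_ge0 (Aneg p c).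
    - by rewrite !pNc // mulN1r mulrN1 opprK (Apos p).
  (* A node of a third cluster is farther from [l] than [i]; reaching it in at most [size s] arcs
     would give a walk to [i] shorter than [s]. *)
  have reachS j s' : walk A l j s' -> (size s' <= size s)%N ->
      j \in (V c :|: V p)%SET.
    move=> ws' ss'; have [q jq] := inV j; rewrite inE.
    have [<-|qc] := eqVneq q c; first by rewrite jq.
    have [<-|qp] := eqVneq q p; first by rewrite jq orbT.
    have := lt_le_trans (dlt q j qc qp jq) (distance_le ws').
    move=> /distance_lt [s0 /smin ss0]; rewrite lte_fin ltr_nat.
    by rewrite ltnNge (leq_trans ss' ss0).
  have pow := signed_expmx_ge0 sgl sg2 SA reachS (leqnn _).
  have sgN j : j \notin V c -> sg j = -1 by rewrite /sg => /negbTE ->.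
  (* Followers have sign -1, so there the entries of the negated column are the signed entries
     controlled by [pow]. *)
  exists (-1 *: (A ^+ size s *m delta_mx l 0)); split.
  - by apply: subspaceZ => //; exact: WA.
  - have [_ /(_ s ws erefl)] := pow i.
    by rewrite -colE sgN // !mxE.
  - by move=> j jc; have [+ _] := pow j; rewrite -colE sgN // !mxE.
pose v0 := \sum_i u i.
have v0gt0 j : j \notin V c -> 0 < v0 j 0.
  move=> jc; rewrite /v0 summxE (bigD1 j) //=; apply: ltr_pwDl.
    by have [] := uP j.
  by apply: sumr_ge0 => i _; have [_ _ /(_ j jc)] := uP i.
(* The coefficient outweighs a negative entry of [v0] at [l], and [delta_mx l 0] leaves the
   followers unchanged. *)
exists (\sum_(l in V c) (1 + `|v0 l 0|) *: delta_mx l 0 + v0).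
  rewrite -[X in X + _]scale1r; apply: (proj2 subW).
    apply: subspace_sum => // l lc; apply: subspaceZ => //.
    by apply: e_leader => //; apply: leq_ltn_trans (ltn_ord l).
  by apply: subspace_sum => // i _; have [] := uP i.
move=> j; rewrite mxE summxE.
have [jc|jc] := boolP (j \in V c); last first.
  rewrite big1 ?add0r ?v0gt0 // => l lc; rewrite !mxE andbT.
  by rewrite (_ : j == l = false) ?mulr0 //; apply: contraNF jc => /eqP ->.
rewrite (bigD1 j) //= big1 => [|l /andP[lc lj]]; last first.
  by rewrite !mxE eq_sym (negbTE lj) mulr0.
rewrite addr0 !mxE !eqxx mulr1 -addrA ltr_pwDl // -lerBlDr sub0r.
by rewrite -normrN ler_norm.
Qed.

(** * Steering in discrete time *)

Lemma scale_ge (R : realType) (n : nat) (v a : 'cV[R]_n) (h : R) :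
  (forall i, 0 < v i 0) -> exists r, forall i, h <= (a + r *: v) i 0.
Proof.
(* A sum of nonnegative quotients dominates each of them, so one [r] serves every entry. *)
move=> v0; exists (\sum_i `|h - a i 0| / v i 0) => i.
rewrite !mxE -lerBlDl -ler_pdivrMr // (bigD1 i) //=.
apply: ler_wpDr.
  by apply: sumr_ge0 => j _; rewrite divr_ge0 // ltW.
by rewrite ler_pM2r ?invr_gt0 // ler_norm.
Qed.

Lemma discrete_steering (R : realType) (n m : nat) (A : 'M[R]_n)
    (B : 'M[R]_(n, m)) (v : 'cV[R]_n) :
    (0 < n)%N -> controllable_image A B v -> (forall i, 0 < v i 0) ->
  herdable_discrete_time A B.
Proof.
move=> n0 [w vE] v0 x0 h _.
have [r rP] := scale_ge (A ^+ n *m x0) h v0.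
(* Inputs are used in reverse order: [r *: w s] is applied at time [n - 1 - s], so that by time [n]
   its effect is multiplied by [A ^+ s]. *)
pose x t := A ^+ t *m x0 +
  r *: \sum_(s < t) A ^+ s *m (B *m w (n - t + s)%N).
exists n, (fun t => r *: w (n - t.+1)%N), x; split => //.
  move=> t tn; rewrite /x big_ord_recl expr0 mul1mx addn0.
  rewrite mulmxDr mulmxA -scalemxAr -expmxS -addrA; congr (_ + _).
  rewrite -scalemxAr. rewrite -scalerDr addrC mulmx_sumr. congr (_ *: (_ + _)).
  apply: eq_bigr => s _; rewrite (mulmxA A) -expmxS /= /bump add1n.
  by rewrite addnS -addSn subnSK.
split; last first.
  move=> i; rewrite /x subnn.
  by under [in X in _ <= X]eq_bigr do rewrite add0n; rewrite -vE.
by rewrite /x expr0 mul1mx big_ord0 scaler0 addr0.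
Qed.

(** * Polynomial trajectories in continuous time *)

Section PolynomialSteering.
Variables (R : realType) (n m : nat) (A : 'M[R]_n) (B : 'M[R]_(n, m)).

(** With polynomial entries in [xi] and [U], the differential equation becomes an algebraic
    identity. *)
Definition polynomial_reach : set 'cV[R]_n :=
  [set v | exists (xi : 'cV[{poly R}]_n) (U : 'cV[{poly R}]_m),
    [/\ map_mx (@deriv R) xi = map_mx polyC A *m xi + map_mx polyC B *m U,
        map_mx (horner^~ 0) xi = 0 & map_mx (horner^~ 1) xi = v]].

Lemma subspace_polynomial_reach : subspace polynomial_reach.
Proof.
split.
  exists 0, 0; rewrite !mulmx0 addr0.
  by split; apply/matrixP => i j; rewrite !mxE ?deriv0 ?horner0.
move=> a _ _ [xi [U [dxi xi0 <-]]] [xi' [U' [dxi' xi0' <-]]].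
exists (a%:P *: xi + xi'), (a%:P *: U + U'); split.
- rewrite !mulmxDr -!scalemxAr addrACA -scalerDr -dxi -dxi'.
  by apply/matrixP => i j; rewrite !mxE derivD mul_polyC derivZ -mul_polyC.
- apply/matrixP => i j; move/matrixP/(_ i j): xi0; move/matrixP/(_ i j): xi0'.
  by rewrite !mxE hornerD hornerM hornerC => -> ->; rewrite mulr0 addr0.
- by apply/matrixP => i j; rewrite !mxE hornerD hornerM hornerC.
Qed.

(** Coefficient of [X ^ k] in the quotient of [chi_A(X) - chi_A(A)] by [X - A]. *)
Definition resolvent_coef (k : nat) : 'M[R]_n :=
  \sum_(e < n - k) (char_poly A)`_(k.+1 + e) *: A ^+ e.

Lemma resolvent_coef_ge (k : nat) : (n <= k)%N -> resolvent_coef k = 0.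
Proof.
by rewrite -subn_eq0 /resolvent_coef => /eqP ->; rewrite big_ord0.
Qed.

(** This is the coefficient of [X ^ (k + 1)] in the identity [(X - A) adj(X - A) = chi_A(X)]. *)
Lemma resolvent_coefS (k : nat) : (k < n)%N ->
  (char_poly A)`_k.+1 *: 1%:M + A *m resolvent_coef k.+1 = resolvent_coef k.
Proof.
move=> kn; rewrite /resolvent_coef -[(n - k)%N]prednK ?subn_gt0 //.
rewrite big_ord_recl /= expr0 addn0 -subnS mulmx_sumr; congr (_ + _).
apply: eq_bigr => e _; rewrite -scalemxAr /bump /= add1n exprS.
by rewrite addnS addSn.
Qed.

Lemma Cayley_Hamilton_sum : \sum_(k < n.+1) (char_poly A)`_k *: A ^+ k = 0.
Proof.
case: n A => [|n'] M; first by apply/matrixP => -[].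
have E : char_poly M = \sum_(k < n'.+2) (char_poly M)`_k *: 'X^k.
  by rewrite -[LHS]coefK poly_def size_char_poly.
have := Cayley_Hamilton M; rewrite [X in horner_mx _ X]E raddf_sum => CH.
rewrite -[RHS]CH; apply: eq_bigr => k _ /=.
by rewrite linearZ rmorphXn /= horner_mx_X.
Qed.

(** The constant coefficient of the same identity, where Cayley-Hamilton enters. *)
Lemma resolvent_coef0 :
  (char_poly A)`_0 *: 1%:M + A *m resolvent_coef 0 = 0.
Proof.
rewrite -[RHS]Cayley_Hamilton_sum big_ord_recl expr0 /resolvent_coef subn0.
rewrite mulmx_sumr; congr (_ + _); apply: eq_bigr => e _.
by rewrite -scalemxAr exprS.
Qed.

(* The [resolvent_coef k] are the coefficients of [adj ('X - A)]; the input of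
   the trajectory below is [char_poly A (d/dt) y]. *)
Lemma polynomial_trajectory (y : {poly R}) (w : 'cV[R]_m) :
  (forall k, (k < n)%N -> y^`(k).[0] = 0) ->
  polynomial_reach (\sum_(k < n) y^`(k).[1] *: (resolvent_coef k *m (B *m w))).
Proof.
move=> y0.
exists (\col_i \sum_(k < n) (resolvent_coef k *m (B *m w)) i 0 *: y^`(k)).
exists (\col_j (w j 0 *: \sum_(k < n.+1) (char_poly A)`_k *: y^`(k))).
split.
- apply/matrixP => i z; rewrite !mxE ord1 linear_sum /=.
  pose N k := resolvent_coef k *m (B *m w).
  transitivity (\sum_(k < n) y^`(k.+1) * ((N k) i 0)%:P).
    by apply: eq_bigr => k _; rewrite derivZ -derivnS mulrC mul_polyC.
  (* Adding the index [k = n], where [resolvent_coef] vanishes, aligns this sum with that of the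
     input term. *)
  have -> : \sum_j map_mx polyC A i j *
      (\col_i0 \sum_(k < n) (N k) i0 0 *: y^`(k)) j 0 =
      \sum_(k < n.+1) y^`(k) * ((A *m N k) i 0)%:P.
    rewrite big_ord_recr /= /N resolvent_coef_ge // mul0mx mulmx0 !mxE.
    rewrite mulr0 addr0; under eq_bigr do rewrite !mxE mulr_sumr.
    rewrite exchange_big; apply: eq_bigr => k _ /=.
    rewrite mxE raddf_sum /= mulr_sumr; apply: eq_bigr => j _.
    by rewrite polyCM -mul_polyC mulrA mulrC.
  have -> : \sum_j map_mx polyC B i j *
      (\col_j0 (w j0 0 *: \sum_(k < n.+1) (char_poly A)`_k *: y^`(k))) j 0 =
      \sum_(k < n.+1) y^`(k) * (((char_poly A)`_k *: (B *m w)) i 0)%:P.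
    rewrite (eq_bigr (fun j => \sum_(k < n.+1)
        y^`(k) * ((char_poly A)`_k * (B i j * w j 0))%:P)).
      rewrite exchange_big; apply: eq_bigr => k _ /=.
      by rewrite !mxE mulr_sumr raddf_sum mulr_sumr.
    move=> j _; rewrite !mxE scaler_sumr mulr_sumr; apply: eq_bigr => k _.
    by rewrite -!mul_polyC !polyCM; ring.
  have NE k : (A *m N k) i 0 + ((char_poly A)`_k *: (B *m w)) i 0 =
      (((char_poly A)`_k *: 1%:M + A *m resolvent_coef k) *m (B *m w)) i 0.
    by rewrite mulmxDl -scalemxAl mul1mx mulmxA addrC [RHS]mxE.
  rewrite -big_split /=; under [RHS]eq_bigr do rewrite -mulrDr -polyCD NE.
  (* The coefficient of [y] itself vanishes; that of the derivative of order [k + 1] reduces to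
     [resolvent_coef k], as on the left. *)
  rewrite big_ord_recl resolvent_coef0 mul0mx mxE mulr0 add0r.
  by apply: eq_bigr => k _; rewrite resolvent_coefS.
- apply/matrixP => i j; rewrite !mxE horner_sum big1 // => k _.
  by rewrite hornerZ y0 ?mulr0.
- apply/matrixP => i j; rewrite !mxE horner_sum summxE; apply: eq_bigr => k _.
  by rewrite hornerZ ord1 [RHS]mxE mulrC.
Qed.

(** By the product rule, each derivative takes one factor off the power, while differentiating the
    cofactor leaves an extra factor that vanishes at [a]. *)
Lemma derivn_Xsub_exp (a : R) (k i : nat) (q : {poly R}) : (i <= k)%N ->
  exists2 r : {poly R}, (('X - a%:P) ^+ k * q)^`(i) = ('X - a%:P) ^+ (k - i) * r
    & r.[a] = (k ^_ i)%:R * q.[a].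
Proof.
elim: i => [|i IHi] ik.
  by exists q; rewrite ?subn0 ?ffactn0 ?mul1r.
have [r Er ra] := IHi (ltnW ik).
exists ((k - i)%:R *: r + ('X - a%:P) * r^`()).
  rewrite derivnS Er derivM deriv_exp derivXsubC mul1r -subnSK //=.
  rewrite mulrDr mulrnAl -mulrnAr scaler_nat; congr (_ + _).
  by rewrite mulrA -exprSr.
rewrite hornerD hornerZ hornerM !hornerE subrr mul0r addr0 ra.
by rewrite mulrA -natrM ffactnSr mulnC.
Qed.

(* With [y = X^n (X - 1)^k / k!] and [k = n - 1 - d], the endpoint reached at
   time 1 is [A ^+ d *m (B *m w)] up to lower powers of [A] and to the
   [resolvent_coef j] with [k < j], which only involve lower powers too. *)
Lemma polynomial_reach_pow (d : nat) (w : 'cV[R]_m) :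
  (d < n)%N -> polynomial_reach (A ^+ d *m (B *m w)).
Proof.
have subW := subspace_polynomial_reach.
elim/ltn_ind: d => d IHd dn.
(* For such [j], [resolvent_coef j] involves only powers [A ^+ e] with [e < d], covered by the
   induction. *)
have reachN a j : (n - d <= j)%N ->
    polynomial_reach (a *: (resolvent_coef j *m (B *m w))).
  move=> dj; apply: subspaceZ => //; rewrite mulmx_suml.
  apply: subspace_sum => // e _; rewrite -scalemxAl; apply: subspaceZ => //.
  have ed : (e < d)%N by have := ltn_ord e; lia.
  by apply: IHd => //; exact: ltn_trans dn.
pose k := (n - d.+1)%N; have kn : (k < n)%N by rewrite /k; lia.
(* The zero of order [n] at 0 gives the initial conditions; the one of order [k] at 1, scaled by
   [1 / k!], singles out the derivative of order [k] among those of order at most [k]. *)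
pose y : {poly R} := (k`!%:R^-1)%:P * ('X - 0%:P) ^+ n * ('X - 1%:P) ^+ k.
have y0 i : (i < n)%N -> y^`(i).[0] = 0.
  move=> lin; rewrite /y -mulrA mulrCA.
  have [r -> _] := derivn_Xsub_exp 0 ((k`!%:R^-1)%:P * ('X - 1%:P) ^+ k) (ltnW lin).
  by rewrite hornerM horner_exp hornerXsubC subrr expr0n subn_eq0 leqNgt lin mul0r.
have y1 i : (i <= k)%N -> y^`(i).[1] = (i == k)%:R.
  move=> ik; rewrite /y mulrC.
  have [r -> r1] := derivn_Xsub_exp 1 ((k`!%:R^-1)%:P * ('X - 0%:P) ^+ n) ik.
  rewrite hornerM horner_exp r1 hornerXsubC subrr expr0n hornerM hornerC.
  rewrite horner_exp hornerXsubC subr0 expr1n mulr1.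
  have [->|nik] := eqVneq i k.
    by rewrite subnn mul1r ffactnn divff // pnatr_eq0 -lt0n fact_gt0.
  by rewrite (_ : (k - i == 0)%N = false) ?mul0r //; lia.
have := polynomial_trajectory w y0.
rewrite (bigID (fun j : 'I_n => (j <= k)%N)) /= (bigD1 (Ordinal kn)) //= y1 //.
rewrite eqxx scale1r big1 ?addr0 => [Wxi|j /andP[jk njk]]; last first.
  by rewrite y1 // -[_ == _]/(j == Ordinal kn) (negbTE njk) scale0r.
have nkd : (n - k)%N = d.+1 by rewrite /k; lia.
(* As [char_poly A] is monic, the term [e = d] of [resolvent_coef k] is exactly [A ^+ d]. *)
have -> : A ^+ d *m (B *m w) = resolvent_coef k *m (B *m w) -
    \sum_(e < d) (char_poly A)`_(k.+1 + e) *: (A ^+ e *m (B *m w)).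
  rewrite /resolvent_coef nkd mulmx_suml big_ord_recr /= addrC.
  under eq_bigr do rewrite -scalemxAl.
  rewrite addrK -scalemxAl (_ : (k.+1 + d)%N = n); last by rewrite /k; lia.
  have := monicP (char_poly_monic A).
  by rewrite /lead_coef size_char_poly /= => ->; rewrite scale1r.
apply: subspaceB => //; last first.
  apply: subspace_sum => // e _; apply: subspaceZ => //.
  by apply: IHd => //; apply: ltn_trans dn.
rewrite -[X in polynomial_reach X](addrK
  (\sum_(j < n | ~~ (j <= k)%N) y^`(j).[1] *: (resolvent_coef j *m (B *m w)))).
apply: subspaceB => //; apply: subspace_sum => // j.
by rewrite -ltnNge => kj; apply: reachN; rewrite /k in kj *; lia.
Qed.

End PolynomialSteering.

(** * The free response as a power series *)

Section FreeResponse.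
Variables (R : realType) (n : nat) (A : 'M[R]_n).

(** The sum of the absolute values of all entries of [A] bounds its operator norm for the 1-norm;
    the geometric bound allows comparison with an exponential series. *)
Lemma norm_expmx_le (x0 : 'cV[R]_n) (k : nat) (i : 'I_n) :
  `|(A ^+ k *m x0) i 0| <=
  (\sum_j \sum_h `|A j h|) ^+ k * \sum_j `|x0 j 0|.
Proof.
suff H : \sum_j `|(A ^+ k *m x0) j 0| <=
    (\sum_j \sum_h `|A j h|) ^+ k * \sum_j `|x0 j 0|.
  by apply: le_trans H; rewrite (bigD1 i) //= lerDl sumr_ge0.
elim: k => [|k IHk]; first by rewrite expr0 mul1r mul1mx.
have a0 : 0 <= \sum_j \sum_h `|A j h|.
  by apply: sumr_ge0 => j _; exact: sumr_ge0.
rewrite expmxS -mulmxA exprS -mulrA; apply: le_trans (ler_wpM2l a0 IHk).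
rewrite mulr_suml; apply: ler_sum => j _.
rewrite mxE; apply: le_trans (ler_norm_sum _ _ _) _.
rewrite mulr_suml; apply: ler_sum => h _; rewrite normrM ler_wpM2l //.
by rewrite (bigD1 h) //= lerDl sumr_ge0.
Qed.

Definition exp_coef (x0 : 'cV[R]_n) (i : 'I_n) (k : nat) : R :=
  (A ^+ k *m x0) i 0 / k`!%:R.

(** This is [e^(tA) x0], written with scalar power series so that termwise differentiation
    applies. *)
Definition free_response (x0 : 'cV[R]_n) (t : R) : 'cV[R]_n :=
  \col_i limn (pseries (exp_coef x0 i) t).

Lemma cvg_exp_coef (x0 : 'cV[R]_n) (i : 'I_n) (t : R) :
  cvgn (pseries (exp_coef x0 i) t).
Proof.
apply: normed_cvg.
pose a := \sum_j \sum_h `|A j h|.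
have a0 : 0 <= a by apply: sumr_ge0 => j _; exact: sumr_ge0.
pose C := \sum_j `|x0 j 0|.
have C0 : 0 <= C by exact: sumr_ge0.
apply: (@series_le_cvg _ _ (fun k => C * exp_coeff (a * `|t|) k)) => [k|k|k|].
- by rewrite /=.
- by rewrite mulr_ge0 // exp_coeff_ge0 // mulr_ge0.
- rewrite /exp_coef /exp_coeff /= exprMn !normrM normrX.
  rewrite [`|_^-1|]ger0_norm ?invr_ge0 // mulrAC !mulrA ler_wpM2r ?invr_ge0 //.
  by rewrite ler_wpM2r ?exprn_ge0 // mulrC norm_expmx_le.
- exact: (is_cvg_seriesZ (k := C) (is_cvg_series_exp_coeff (a * `|t|))).
Qed.

(** On coefficients, the derivative of [e^(tA) x0] is [e^(tA) A x0]. *)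
Lemma exp_coef_diffs (x0 : 'cV[R]_n) (i : 'I_n) :
  pseries_diffs (exp_coef x0 i) = exp_coef (A *m x0) i.
Proof.
apply/funext => k; rewrite /pseries_diffs /exp_coef factS natrM.
by rewrite mulmxA -[A ^+ k *m A]exprSr invfM mulrCA mulVKf.
Qed.

Lemma free_response_mulmx (x0 : 'cV[R]_n) (t : R) :
  free_response (A *m x0) t = A *m free_response x0 t.
Proof.
apply/matrixP => i z; rewrite !mxE.
apply/cvg_lim => //; under [X in _ --> X]eq_bigr do rewrite mxE.
have -> : pseries (exp_coef (A *m x0) i) t =
    (fun N => \sum_j A i j * pseries (exp_coef x0 j) t N).
  apply/funext => N; rewrite /pseries /series /=.
  under [RHS]eq_bigr do rewrite mulr_sumr.
  rewrite exchange_big; apply: eq_bigr => k _ /=.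
  rewrite /exp_coef mulmxA -[A ^+ k *m A]exprSr expmxS -mulmxA mxE !mulr_suml.
  by apply: eq_bigr => j _; rewrite !mulrA.
apply: cvg_big => [|j _]; first exact: add_continuous.
apply: cvgMl_tmp; exact: cvg_exp_coef.
Qed.

Lemma is_derive_free_response (x0 : 'cV[R]_n) (t : R) (i : 'I_n) :
  is_derive t 1 (fun s => free_response x0 s i 0)
    ((A *m free_response x0 t) i 0).
Proof.
rewrite -free_response_mulmx mxE -exp_coef_diffs.
under eq_fun do rewrite mxE.
(* Termwise differentiation asks for convergence of the series and its first two formal derivatives
   at a point of modulus above that of [t]. *)
apply: (@pseries_snd_diffs _ _ (`|t| + 1)).
- exact: cvg_exp_coef.
- by rewrite exp_coef_diffs; exact: cvg_exp_coef.
- by rewrite !exp_coef_diffs; exact: cvg_exp_coef.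
- by rewrite [`|_ + 1|]ger0_norm ?ltrDl ?addr_ge0.
Qed.

Lemma free_response0 (x0 : 'cV[R]_n) : free_response x0 0 = x0.
Proof.
apply/matrixP => i z; rewrite mxE ord1; apply/cvg_lim => //.
(* The empty partial sum is 0; after a shift by one the sequence is constant. *)
rewrite -(cvg_shiftS _).
apply: cvg_near_cst; near=> N.
rewrite /pseries /series /= big_nat_recl // expr0 mulr1 /exp_coef fact0 divr1.
rewrite expr0 mul1mx big1 ?addr0 // => k _.
by rewrite expr0n mulr0.
Unshelve. all: by end_near. Qed.

End FreeResponse.

(** * Steering in continuous time *)

Lemma is_derive_horner (R : realType) (p : {poly R}) (t : R) :
  is_derive t (1 : R) (horner p) p^`().[t].
Proof.
by apply: DeriveDef; [exact: derivable_horner | rewrite derivE derive1E].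
Qed.

Lemma continuous_steering (R : realType) (n m : nat) (A : 'M[R]_n)
    (B : 'M[R]_(n, m)) (v : 'cV[R]_n) :
    controllable_image A B v -> (forall i, 0 < v i 0) ->
  herdable_continuous_time A B.
Proof.
move=> [w vE] v0 x0 h _.
have [xi [U [dxi xi0 xi1]]] : polynomial_reach A B v.
  rewrite vE; apply: subspace_sum => [|t _].
    exact: subspace_polynomial_reach.
  exact: polynomial_reach_pow.
have [r rP] := scale_ge (free_response A x0 1) h v0.
pose x t : 'cV[R]_n :=
  free_response A x0 t + r *: map_mx (horner^~ t) xi.
pose u t : 'cV[R]_m := r *: map_mx (horner^~ t) U.
(* Evaluation at [t] commutes with constant matrices, which turns [dxi] into the differential
   equation at time [t]. *)
have ev t (p q : nat) (M : 'M[R]_(p, q)) (N : 'cV[{poly R}]_q) :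
    map_mx (horner^~ t) (map_mx polyC M *m N) = M *m map_mx (horner^~ t) N.
  apply/matrixP => i z; rewrite !mxE horner_sum; apply: eq_bigr => j _.
  by rewrite !mxE hornerM hornerC.
have dx (t : R) (i : 'I_n) : is_derive t (1 : R) (fun s => x s i 0) ((A *m x t + B *m u t) i 0).
  rewrite /x /u mulmxDr -!scalemxAr -addrA -scalerDr -!ev.
  have -> : map_mx (horner^~ t) (map_mx polyC A *m xi) +
      map_mx (horner^~ t) (map_mx polyC B *m U) =
      map_mx (horner^~ t) (map_mx (@deriv R) xi).
    by rewrite dxi; apply/matrixP => j z; rewrite !mxE hornerD.
  rewrite [X in is_derive _ _ _ X]mxE.
  under eq_fun do rewrite mxE.
  have df := is_derive_free_response A x0 t i.
  apply: is_deriveD.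
  rewrite !mxE; under eq_fun do rewrite !mxE.
  have dh := is_derive_horner (xi i 0) t.
  exact: is_deriveZ.
exists 1, u, x; split.
- exact: ltr01.
- move=> j; apply: continuous_subspaceT => t.
  rewrite /u; under eq_fun do rewrite !mxE.
  by apply: cvgMl_tmp; exact: continuous_horner.
- move=> i; apply: continuous_subspaceT => t.
  have [+ _] := dx t i.
  by move=> /derivable1_diffP/differentiable_continuous.
- by move=> t _ i; exact: dx.
split; last by move=> i; rewrite /x xi1.
by rewrite /x free_response0 xi0 scaler0 addr0.
Qed.

Theorem proposition3 (R : realType) (n m k : nat)
    (A : 'M[R]_n) (B : 'M[R]_(n, m))
    (V : 'I_k -> {set 'I_n}) (c : 'I_k)
    (hbal : clustering_balanced A V)
    (hsel : selection_matrix B)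
    (hlead : leaders B = V c)
    (hm : m = #|leaders B|) (hmn : (m < n)%N)
    (hdist : forall (p : 'I_k) (i : 'I_n), p != c -> i \in V p ->
       exists l : 'I_n,
         [/\ l \in leaders B,
             (distance A l i < +oo)%E
           & forall (q : 'I_k) (j : 'I_n), q != c -> q != p -> j \in V q ->
               (distance A l i < distance A l j)%E]) :
  herdable_continuous_time A B /\ herdable_discrete_time A B.
Proof.
rewrite hlead in hdist.
have n0 : (0 < n)%N by exact: leq_ltn_trans hmn.
have [v vB v0] : exists2 v, controllable_image A B v & forall i, 0 < v i 0.
  apply: (positive_direction hbal hdist) => [|l d lc dn].
    exact: subspace_controllable_image.
  have [w <-] : exists w : 'cV[R]_m, B *m w = delta_mx l 0.
    by apply: leader_column; rewrite ?hlead.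
  exact: controllable_image_pow.
by split; [exact: continuous_steering vB v0 | exact: discrete_steering vB v0].
Qed.
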